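(* Let $p$ be an odd prime. Then there are no primitive formally dual configurations in $G=\mathbb{Z}/p^2\mathbb{Z}$ and its dual; that is, there is no primitive pair of formally dual subsets $S\subseteq G$ and $T\subseteq\widehat G$.
   Context: Let $G$ be a finite abelian group with character group $\widehat G$ and pairing $\langle\cdot,\cdot\rangle\colon G\times\widehat G\to S^1\subset\mathbb{C}^*$. Nonempty subsets $S\subseteq G$ and $T\subseteq\widehat G$ are formally dual if the following equivalent conditions hold: (1) for every $y\in\widehat G$, $\left|\frac{1}{|S|}\sum_{v\in S}\langle v,y\rangle\right|^2=\frac{1}{|T|}\cdot\#\{(w,w')\in T\times T \mid y=w-w'\}$; (2) for every $f\colon G\to\mathbb{C}$, $\frac{1}{|S|^{3/2}}\sum_{v,v'\in S}f(v-v')=\frac{1}{|T|^{3/2}}\sum_{w,w'\in T}\widehat f(w-w')$, where $\widehat f(y)=\frac{1}{\sqrt{|G|}}\sum_{x\in G}f(x)\overline{\langle x,y\rangle}$. A formally dual pair $(S,T)$ is primitive if $S$ is not contained in a coset of a proper subgroup of $G$ and $T$ is not contained in a coset of a proper subgroup of $\widehat G$. *)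

(* Defs.v *)
From HB Require Import structures.
From mathcomp Require Import all_boot all_order all_fingroup all_algebra.
From mathcomp Require Import cyclic reals.
From mathcomp Require Export complex.

Set Implicit Arguments.
Unset Strict Implicit.
Unset Printing Implicit Defensive.

Import Order.TTheory GRing.Theory Num.Theory.
Local Open Scope ring_scope.

Section CharacterGroup.
Variables (C : numClosedFieldType) (G : finZmodType).

(* group homomorphisms from G to the unit circle of C *)
Definition is_character (chi : {ffun G -> C}) : bool :=
  [forall x, `|chi x| == 1] && [forall x, forall y, chi (x + y) == chi x * chi y].

Record char_group := Character {
  char_val :> {ffun G -> C};
  _ : is_character char_val
}.

HB.instance Definition _ := [isSub for char_val].
HB.instance Definition _ := [Choice of char_group by <:].

Lemma character_norm (chi : char_group) x : `|chi x| = 1.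
Proof. by case: chi => f /= /andP[/forallP/(_ x)/eqP]. Qed.

Lemma characterD (chi : char_group) x y : chi (x + y) = chi x * chi y.
Proof. by case: chi => f /= /andP[_ /forallP/(_ x)/forallP/(_ y)/eqP]. Qed.

Lemma character_neq0 (chi : char_group) x : chi x != 0.
Proof. by rewrite -normr_eq0 character_norm oner_eq0. Qed.

Lemma character0 (chi : char_group) : chi 0 = 1.
Proof.
by apply: (mulfI (character_neq0 chi 0)); rewrite -characterD addr0 mulr1.
Qed.

Lemma characterMn (chi : char_group) x n : chi (x *+ n) = chi x ^+ n.
Proof.
by elim: n => [|n IHn]; rewrite ?mulr0n ?character0 // mulrS characterD IHn exprS.
Qed.

Lemma character_unity (chi : char_group) x : chi x ^+ #|G| = 1.
Proof.
rewrite -characterMn.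
have <- : chi 0 = 1 by exact: character0.
congr (chi _); have := @expg_cardG G [group of [set: G]] x (in_setT x).
by rewrite FinRing.zmodXgE cardsT.
Qed.

(* The group law is pointwise multiplication, written additively, so that
   the difference of two characters is their pointwise quotient. *)
Lemma char_zero_subproof : is_character [ffun=> 1].
Proof.
apply/andP; split; apply/forallP => x; first by rewrite ffunE normr1.
by apply/forallP => y; rewrite !ffunE mulr1.
Qed.
Definition char_zero := Character char_zero_subproof.

Lemma char_opp_subproof (chi : char_group) :
  is_character [ffun x => (chi x)^-1].
Proof.
apply/andP; split; apply/forallP => x.
  by rewrite ffunE normfV character_norm invr1.
by apply/forallP => y; rewrite !ffunE characterD invfM.
Qed.
Definition char_opp chi := Character (char_opp_subproof chi).

Lemma char_add_subproof (chi psi : char_group) :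
  is_character [ffun x => chi x * psi x].
Proof.
apply/andP; split; apply/forallP => x.
  by rewrite ffunE normrM !character_norm mulr1.
by apply/forallP => y; rewrite !ffunE !characterD mulrACA.
Qed.
Definition char_add chi psi := Character (char_add_subproof chi psi).

Lemma char_addA : associative char_add.
Proof. by move=> a b c; apply/val_inj/ffunP => x; rewrite !ffunE mulrA. Qed.
Lemma char_addC : commutative char_add.
Proof. by move=> a b; apply/val_inj/ffunP => x; rewrite !ffunE mulrC. Qed.
Lemma char_add0 : left_id char_zero char_add.
Proof. by move=> a; apply/val_inj/ffunP => x; rewrite !ffunE mul1r. Qed.
Lemma char_addN : left_inverse char_zero char_opp char_add.
Proof.
by move=> a; apply/val_inj/ffunP => x; rewrite !ffunE mulVf ?character_neq0.
Qed.

HB.instance Definition _ :=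
  GRing.isZmodule.Build char_group char_addA char_addC char_add0 char_addN.

(* Finiteness: the values of a character are #|G|-th roots of unity. *)
Definition char_values : seq C :=
  sval (closed_field_poly_normal ('X^#|G| - 1 : {poly C})).

Lemma char_valuesP (chi : char_group) x : chi x \in char_values.
Proof.
have G_gt0 : (0 < #|G|)%N by apply/card_gt0P; exists 0.
rewrite /char_values; case: closed_field_poly_normal => r /= r_def.
rewrite -root_prod_XsubC.
have := congr1 (fun q => root q (chi x)) r_def.
rewrite /root lead_coefDl ?lead_coefXn ?scale1r => [<-|].
  by rewrite !hornerE character_unity subrr.
by rewrite size_polyN size_poly1 size_polyXn ltnS.
Qed.

Definition char_encode (chi : char_group) : {ffun G -> seq_sub char_values} :=
  [ffun x => SeqSub (char_valuesP chi x)].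

Lemma char_encode_inj : injective char_encode.
Proof.
move=> a b eq_ab; apply/val_inj/ffunP => x.
by move/ffunP/(_ x): eq_ab; rewrite !ffunE => -[].
Qed.

Definition char_decode (f : {ffun G -> seq_sub char_values}) :
    option char_group :=
  insub [ffun x => ssval (f x)].

Lemma char_encodeK : pcancel char_encode char_decode.
Proof.
move=> a; rewrite /char_decode.
suff -> : [ffun x => ssval (char_encode a x)] = val a by rewrite valK.
by apply/ffunP => x; rewrite !ffunE.
Qed.

HB.instance Definition _ := PCanIsCountable char_encodeK.
HB.instance Definition _ :=
  isFinite.Build char_group (pcan_enumP char_encodeK).

End CharacterGroup.

Section FormalDuality.
Variables (C : numClosedFieldType) (G : finZmodType).

(* |S|^-1 sum_(v in S) <v, y> has squared modulus |T|^-1 #{(w, w') | y = w - w'};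
   the pairing <v, y> is the value y v of the character y at v. *)
Definition formally_dual (S : {set G}) (T : {set char_group C G}) : Prop :=
  [/\ S != set0, T != set0 &
      forall y : char_group C G,
        `| #|S|%:R^-1 * \sum_(v in S) y v | ^+ 2
        = #|T|%:R^-1 *
          #|[set w in setX T T | y == w.1 - w.2]|%:R :> C].

End FormalDuality.

Definition in_proper_coset (A : finZmodType) (S : {set A}) : Prop :=
  exists (H : {group A}) (x : A),
    H \proper [set: A] /\ S \subset [set x + h | h in H].

Definition primitive_formally_dual (C : numClosedFieldType) (G : finZmodType)
    (S : {set G}) (T : {set char_group C G}) : Prop :=
  [/\ formally_dual S T, ~ in_proper_coset S & ~ in_proper_coset T].

(* Main.v *)
Require Import Defs.
From mathcomp Require Import all_boot all_order all_fingroup all_algebra.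
From mathcomp Require Import cyclic separable algC cyclotomic zify reals.

(* Formal duality forces |S| |T| = p^2, and a set with a single element lies in a
   coset of the trivial subgroup, so |S| = |T| = p.  By Galois conjugation (the
   cyclotomic polynomials are irreducible), the number n of pairs in T x T with
   a given difference d is the same for all d generating Z/p^2.  Counting pairs
   gives n <= 1.  If n = 0, then T lies in a coset of pZ/p^2.  If n = 1, then no
   nonzero element of pZ/p^2 is a difference, so each w in T has exactly one
   partner w' in T with w - w' = 1 mod p, and conversely.  The sum of w - w'
   over these pairs is 0 by telescoping; but it is also the sum of all residues
   mod p^2 that are 1 mod p, which is p because p is odd: a contradiction. *)

Set Implicit Arguments.
Unset Strict Implicit.
Unset Printing Implicit Defensive.

Import Order.TTheory GRing.Theory Num.Theory.
Local Open Scope ring_scope.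

(** * Roots of unity and Galois conjugation *)

(** Since [z ^+ n - 1] is the product of the ['Phi_d] at [z] over [d %| n], some ['Phi_d] vanishes
    at [z]; then [z ^+ d = 1], which forces [d = n]. *)
Lemma root_map_Cyclotomic (F : fieldType) n (z : F) :
  n.-primitive_root z -> root (map_poly intr 'Phi_n) z.
Proof.
move=> prim_z; have n_gt0 := prim_order_gt0 prim_z.
have phiX d : (d > 0)%N ->
    \prod_(e <- divisors d) (map_poly intr 'Phi_e).[z] = z ^+ d - 1.
  move=> d_gt0; rewrite -horner_prod -rmorph_prod prod_Cyclotomic //.
  by rewrite rmorphB rmorph1 /= map_polyXn !hornerE.
have /eqP := phiX n n_gt0; rewrite (prim_expr_order prim_z) subrr prodf_seq_eq0.
case/hasP=> d; rewrite -dvdn_divisors // => d_n /= phid0.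
have d_gt0 := dvdn_gt0 n_gt0 d_n.
suff n_d : (n %| d)%N by have/eqP<- : d == n by rewrite eqn_dvd d_n.
rewrite (prim_order_dvd prim_z) -subr_eq0 -(phiX d d_gt0).
by rewrite prodf_seq_eq0; apply/hasP; exists d; rewrite // -dvdn_divisors.
Qed.

(** Galois conjugation without a Galois group. The rational gcd of [q] and ['Phi_n] has the root
    [z], so it is not a nonzero constant and has a root [u] in [algC]. There ['Phi_n] is the minimal
    polynomial of [u], hence divides [q]. *)
Lemma root_prim_root (F : numFieldType) n (z z' : F) (q : {poly int}) :
    n.-primitive_root z -> n.-primitive_root z' ->
  root (map_poly intr q) z -> root (map_poly intr q) z'.
Proof.
move=> prim_z prim_z' qz0.
pose phi : {poly rat} := map_poly intr 'Phi_n.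
pose q1 : {poly rat} := map_poly intr q; pose g := gcdp q1 phi.
have mapQ (K : numFieldType) (r : {poly int}) :
    map_poly (ratr : rat -> K) (map_poly intr r) = map_poly intr r.
  by rewrite -map_poly_comp; apply: eq_map_poly => x /=; rewrite ratr_int.
have g_root (K : numFieldType) (u : K) :
    root (map_poly ratr g) u = root (map_poly intr q) u &&
      root (map_poly intr 'Phi_n) u.
  by rewrite gcdp_map root_gcd !mapQ.
have gz0 : root (map_poly ratr g) z by rewrite g_root qz0 root_map_Cyclotomic.
have [u gu0] : exists u : algC, root (map_poly ratr g) u.
  apply/closed_rootP; rewrite size_map_poly.
  apply: contraL gz0 => /size_poly1P [c c0 ->].
  by rewrite map_polyC rootC fmorph_eq0.
have prim_u : n.-primitive_root u.
  have [w prim_w] := C_prim_root_exists (prim_order_gt0 prim_z).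
  move: gu0; rewrite g_root => /andP[_].
  by rewrite (Cintr_Cyclotomic prim_w) root_cyclotomic.
have [m [minE m_mon]] := minCpolyP u => /(_ g); rewrite gu0 => /esym m_g.
have m_phi : m = phi.
  apply: (map_poly_inj (ratr : {rmorphism rat -> algC})).
  by rewrite -minE (minCpoly_cyclotomic prim_u) mapQ (Cintr_Cyclotomic prim_u).
have /dvdpP[h Dq] : phi %| q1.
  by rewrite -m_phi (dvdp_trans m_g) // dvdp_gcdl.
by rewrite -(mapQ F) -/q1 Dq rmorphM rootM [X in _ || root X _]mapQ
  root_map_Cyclotomic ?orbT.
Qed.

(** In characteristic 0 the polynomial X^n - 1 is separable, so it has n distinct roots, and these
    include a primitive one. *)
Lemma prim_root_exists (F : numClosedFieldType) n :
  (n > 0)%N -> {z : F | n.-primitive_root z}.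
Proof.
move=> n_gt0; have [r Dr] := closed_field_poly_normal ('X^n - 1 : {poly F}).
have lead1 : lead_coef ('X^n - 1 : {poly F}) = 1.
  by apply/eqP; rewrite -monicE monicXnsubC.
rewrite lead1 scale1r in Dr.
have /hasP/sig2W[z _ prim_z] : has n.-primitive_root r; last by exists z.
apply: has_prim_root => //.
- by apply/allP=> x; rewrite /root_of_unity -root_prod_XsubC -Dr.
- by rewrite -separable_prod_XsubC -Dr separable_Xn_sub_1 // pnatr_eq0 -lt0n.
have := congr1 (fun q : {poly F} => size q) Dr.
by rewrite size_prod_XsubC size_XnsubC // => -[->].
Qed.

Lemma in_proper_coset_card1 (A : finZmodType) (S : {set A}) :
  (1 < #|A|)%N -> #|S| = 1%N -> in_proper_coset S.
Proof.
move=> A_gt1 /eqP/cards1P[x ->]; exists 1%G, x; split.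
  by rewrite properEcard sub1G cards1 cardsT.
by apply/subsetP => y /set1P->; apply/imsetP; exists 0; rewrite ?addr0 // inE.
Qed.


(** * Counting pairs by their difference *)

(** The autocorrelation of the indicator function of [S], written as in [formally_dual]. *)
Definition ncorr (A : finZmodType) (S : {set A}) (d : A) : nat :=
  #|[set w in setX S S | d == w.1 - w.2]|.

(** The target [V] is general so as to cover cardinalities, exponential sums and sums of residues
    alike. *)
Lemma sum_ncorr (A : finZmodType) (V : nmodType) (S : {set A}) (P : pred A)
    (f : A -> V) :
  \sum_(w in setX S S | P (w.1 - w.2)) f (w.1 - w.2)
    = \sum_(d | P d) f d *+ ncorr S d.
Proof.
rewrite (partition_big (fun w => w.1 - w.2) P) => [|w /andP[]//].
apply: eq_bigr => d Pd; rewrite -sumr_const; apply: eq_big => [w|w /andP[_]].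
  rewrite [RHS]inE [_ == d]eq_sym -andbA; congr (_ && _).
  by case: eqP => [<-|]; rewrite ?Pd ?andbF.
by move/eqP->.
Qed.

Lemma ncorr0 (A : finZmodType) (S : {set A}) : ncorr S 0 = #|S|.
Proof.
rewrite /ncorr -(card_imset S (f := fun x => (x, x))) => [|x y [//]].
apply: eq_card => -[x y]; rewrite !inE /= eq_sym subr_eq0.
apply/andP/imsetP => [[/andP[xS _] /eqP<-]|[v vS [-> ->]]]; first by exists x.
by rewrite vS eqxx.
Qed.

Lemma ncorr_gt0 (A : finZmodType) (S : {set A}) x y :
  x \in S -> y \in S -> (0 < ncorr S (x - y)%R)%N.
Proof.
by move=> xS yS; apply/card_gt0P; exists (x, y); rewrite !inE /= xS yS eqxx.
Qed.

Lemma card_ncorr (A : finZmodType) (S : {set A}) (P : pred A) :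
  #|[set w in setX S S | P (w.1 - w.2)]| = (\sum_(d | P d) ncorr S d)%N.
Proof.
transitivity (\sum_(d | P d) 1%N *+ ncorr S d)%R; last first.
  by apply: eq_bigr => d _; rewrite -mulr_natr mul1r natn.
rewrite -(sum_ncorr S P (fun=> 1%N)) -sum1_card; apply: eq_bigl => w.
by rewrite inE.
Qed.

Lemma sum_ncorr_all (A : finZmodType) (S : {set A}) :
  (\sum_d ncorr S d = #|S| ^ 2)%N.
Proof.
rewrite -(card_ncorr S xpredT) -mulnn -cardsX.
by apply: eq_card => w; rewrite [LHS]inE andbT.
Qed.

(** Carries primitivity from the character group over to ['Z_N]. The subgroup of [B] is the image of
    [H] under [f], written as a preimage under the inverse [g]. *)
Lemma in_proper_coset_bij (A B : finZmodType) (f : A -> B) (T : {set B}) :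
    bijective f -> {morph f : x y / x + y} ->
  in_proper_coset (f @^-1: T) -> in_proper_coset T.
Proof.
move=> [g fK gK] fD [H [x [prH /subsetP subH]]].
have gD : {morph g : a b / a + b}.
  by move=> a b; rewrite -{1}(gK a) -{1}(gK b) -fD fK.
have g0 : g 0 = 0 by apply: (addrI (g 0)); rewrite -gD !addr0.
have gH : group_set (g @^-1: H).
  apply/group_setP; split=> [|a b]; first by rewrite inE g0; apply: (group1 H).
  by rewrite !inE gD; apply: (@groupM _ H).
exists (Group gH), (f x); split.
  have [_ [a _ aH]] := properP prH.
  by apply/properP; split; [exact: subsetT | exists (f a); rewrite ?inE ?fK].
apply/subsetP=> b bT; have /subH/imsetP[h hH Dgb] : g b \in f @^-1: T.
  by rewrite inE gK.
by apply/imsetP; exists (f h); rewrite ?inE ?fK // -fD -Dgb gK.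
Qed.

(** * Fourier analysis on Z/N *)

(** The modulus built into ['Z_N] is [(Zp_trunc N).+2], which is [N] once [1 < N]. *)
Lemma val_ZpD N (x y : 'Z_N) : (1 < N)%N -> (x + y)%R = ((x + y) %% N)%N :> nat.
Proof. by move=> N_gt1; rewrite -[X in (_ %% X)%N](Zp_cast N_gt1). Qed.

Lemma val_ZpM N (x y : 'Z_N) : (1 < N)%N -> (x * y)%R = ((x * y) %% N)%N :> nat.
Proof. by move=> N_gt1; rewrite -[X in (_ %% X)%N](Zp_cast N_gt1). Qed.

Section CyclicDuality.
Variables (C : numClosedFieldType) (N : nat) (z : C).
Hypotheses (N_gt1 : (1 < N)%N) (prim_z : N.-primitive_root z).

Lemma zexpD (x y : 'Z_N) : z ^+ (x + y)%R = z ^+ x * z ^+ y.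
Proof. by rewrite (val_ZpD _ _ N_gt1) (prim_expr_mod prim_z) exprD. Qed.

Lemma zexpM (x y : 'Z_N) : z ^+ (x * y)%R = z ^+ y ^+ x.
Proof. by rewrite (val_ZpM _ _ N_gt1) (prim_expr_mod prim_z) mulnC exprM. Qed.

Lemma zexp_neq0 (x : 'Z_N) : z ^+ x != 0.
Proof.
have: z ^+ N != 0 by rewrite (prim_expr_order prim_z) oner_neq0.
by rewrite expf_eq0 (prim_order_gt0 prim_z) => /expf_neq0.
Qed.

Lemma zexpB (x y : 'Z_N) : z ^+ (x - y)%R = z ^+ x / z ^+ y.
Proof.
by apply: (mulIf (zexp_neq0 y)); rewrite -zexpD subrK divfK ?zexp_neq0.
Qed.

Lemma zexp_eq1 (x : 'Z_N) : (z ^+ x == 1) = (x == 0).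
Proof.
rewrite -(prim_order_dvd prim_z) -val_eqE /=.
apply/idP/eqP => [|->]; last exact: dvdn0.
rewrite /dvdn modn_small => [/eqP//|].
by rewrite -[X in (_ < X)%N](Zp_cast N_gt1).
Qed.

Lemma zexp_norm (x : 'Z_N) : `|z ^+ x| = 1.
Proof.
rewrite normrX; suff -> : `|z| = 1 by rewrite expr1n.
apply/eqP; rewrite -(@pexpr_eq1 _ _ N) ?(prim_order_gt0 prim_z) //.
by rewrite -normrX (prim_expr_order prim_z) normr1.
Qed.

Lemma zexp_conj (x : 'Z_N) : (z ^+ x)^* = (z ^+ x)^-1.
Proof. by rewrite invC_norm zexp_norm expr1n invr1 mul1r. Qed.

(** Orthogonality: shifting [y] by 1 multiplies the sum by [z ^+ d], which differs from 1 when
    [d != 0]. *)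
Lemma zexp_sum (d : 'Z_N) :
  \sum_(y : 'Z_N) z ^+ (d * y)%R = N%:R *+ (d == 0).
Proof.
case: eqVneq => [->|d0].
  under eq_bigr do rewrite mul0r expr0.
  by rewrite sumr_const card_ord (Zp_cast N_gt1).
have zd1 : z ^+ d - 1 != 0 by rewrite subr_eq0 zexp_eq1.
apply: (mulfI zd1); rewrite mulr0 mulrBl mul1r mulr_sumr; apply/eqP.
rewrite subr_eq0 eq_sym (reindex_inj (addrI 1)); apply/eqP.
by apply: eq_bigr => y _; rewrite mulrDr mulr1 zexpD.
Qed.

(** The power spectrum is the Fourier transform of the autocorrelation: conjugation inverts
    [z ^+ x], so the pair [(v, v')] contributes [z ^+ ((v - v') * y)]. *)
Lemma norm_zexp_sum (S : {set 'Z_N}) y :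
  `|\sum_(v in S) z ^+ (v * y)%R| ^+ 2 = \sum_d z ^+ (d * y)%R *+ ncorr S d.
Proof.
rewrite normCK rmorph_sum big_distrlr pair_big.
rewrite -(sum_ncorr S xpredT (fun d => z ^+ (d * y)%R)).
apply: eq_big => [w|w _]; first by rewrite inE andbT.
by rewrite [X in _ * X = _]zexp_conj mulrBl zexpB.
Qed.

Section DualPair.
Variables S T : {set 'Z_N}.
Hypotheses (S0 : S != set0) (T0 : T != set0).
(** Formal duality with denominators cleared and characters indexed by ['Z_N]; the coefficients are
    then integers, as [root_prim_root] requires. *)
Hypothesis dualST : forall y,
  #|T|%:R * `|\sum_(v in S) z ^+ (v * y)%R| ^+ 2
    = #|S|%:R ^+ 2 * (ncorr T y)%:R.

(** Sum [dualST] over all [y]. By orthogonality only [d = 0] survives on the left, giving |T| N |S|;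
    the right side is |S|^2 |T|^2. *)
Lemma dual_card : (#|S| * #|T|)%N = N.
Proof.
have s0 : #|S|%:R != 0 :> C by rewrite pnatr_eq0 cards_eq0.
have t0 : #|T|%:R != 0 :> C by rewrite pnatr_eq0 cards_eq0.
apply/eqP; rewrite -(eqr_nat C) natrM -(inj_eq (mulfI (mulf_neq0 s0 t0))).
apply/eqP; transitivity (\sum_y (#|S|%:R ^+ 2 * (ncorr T y)%:R : C)).
  by rewrite -mulr_sumr -natr_sum sum_ncorr_all mulrACA -!expr2 natrX.
under eq_bigr do rewrite -dualST norm_zexp_sum.
have sumE d : \sum_(y : 'Z_N) z ^+ (d * y)%R *+ ncorr S d
    = (N%:R *+ (d == 0)) *+ ncorr S d by rewrite sumrMnl zexp_sum.
rewrite -mulr_sumr exchange_big (eq_bigr _ (fun d _ => sumE d)) (bigD1 0) //=.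
rewrite big1 => [|d /negPf->]; last by rewrite mul0rn.
by rewrite ncorr0 addr0 mulr1n -[N%:R *+ _]mulr_natr mulrCA
  [RHS]mulrC [in RHS](mulrC #|S|%:R).
Qed.

Lemma dual_ncorr_coprime (y y' : 'Z_N) :
  coprime y N -> coprime y' N -> ncorr T y = ncorr T y'.
Proof.
move=> co_y co_y'.
(* By duality the value of [q] at [z ^+ x] is |S|^2 ([ncorr T x] - [ncorr T y]). It vanishes at the
   primitive root [z ^+ y], hence also at [z ^+ y']. *)
pose q : {poly int} := \sum_(d : 'Z_N) (#|T| * ncorr S d)%:R *: 'X^d
  - (#|S| ^ 2 * ncorr T y)%:R%:P.
have qE (x : 'Z_N) : (map_poly intr q).[z ^+ x]
    = #|S|%:R ^+ 2 * (ncorr T x)%:R - #|S|%:R ^+ 2 * (ncorr T y)%:R.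
  rewrite rmorphB rmorph_sum hornerD hornerN horner_sum /= map_polyC hornerC.
  congr (_ - _); last by rewrite /= rmorph_nat natrM natrX.
  rewrite -dualST norm_zexp_sum mulr_sumr; apply: eq_bigr => d _.
  rewrite map_polyZ map_polyXn hornerZ hornerXn rmorph_nat natrM (zexpM d x).
  by rewrite -[X in _ = _ * X]mulr_natl mulrA.
have := @root_prim_root C N (z ^+ y) (z ^+ y') q.
rewrite !(prim_root_exp_coprime _ prim_z) co_y co_y' /root !qE subrr eqxx.
move=> /(_ isT isT isT); rewrite subr_eq0 (inj_eq (mulfI _)) ?eqr_nat.
  by move/eqP.
by rewrite expf_neq0 // pnatr_eq0 cards_eq0.
Qed.

End DualPair.
End CyclicDuality.

(** * Sets of p residues modulo p^2 *)

Section PrimeSquare.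
Variable p : nat.
Hypotheses (p_pr : prime p) (p_odd : odd p).

Lemma psq_gt1 : (1 < p ^ 2)%N.
Proof. by rewrite -(exp1n 2) ltn_exp2r ?prime_gt1. Qed.

Lemma dvdn_ZpD (x y : 'Z_(p ^ 2)) :
  (p %| x)%N -> (p %| (x + y)%R)%N = (p %| y)%N.
Proof.
move=> p_x; rewrite (val_ZpD _ _ psq_gt1) /dvdn modn_dvdm ?dvdn_exp //.
exact: dvdn_addr.
Qed.

Lemma dvdn_ZpN (x : 'Z_(p ^ 2)) : (p %| (- x)%R)%N = (p %| x)%N.
Proof.
suff imp (y : 'Z_(p ^ 2)) : (p %| y)%N -> (p %| (- y)%R)%N.
  by apply/idP/idP => [/imp|]; [rewrite opprK | exact: imp].
by move=> p_y; rewrite -(dvdn_ZpD _ p_y) subrr dvdn0.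
Qed.

Lemma coprime_psq (x : 'Z_(p ^ 2)) : coprime x (p ^ 2) = ~~ (p %| x)%N.
Proof. by rewrite coprime_sym coprime_pexpl // prime_coprime. Qed.

Definition pZ : {set 'Z_(p ^ 2)} := [set x : 'Z_(p ^ 2) | (p %| x)%N].

Lemma pZ_group : group_set pZ.
Proof.
apply/group_setP; split=> [|x y]; rewrite !inE ?dvdn0 // => px py.
by rewrite (dvdn_ZpD _ px).
Qed.

Lemma one_notin_pZ : (1 : 'Z_(p ^ 2)) \notin pZ.
Proof. by rewrite inE -coprime_psq coprime1n. Qed.

(** The complement consists of the units, counted by the totient of p^2. *)
Lemma card_pZ : #|pZ| = p /\ #|~: pZ| = (p * p.-1)%N.
Proof.
have CpZ : #|~: pZ| = (p * p.-1)%N.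
  transitivity (totient (p ^ 2)); last by rewrite totient_pfactor // mulnC.
  rewrite totient_count_coprime -[X in index_iota _ X](Zp_cast psq_gt1).
  rewrite big_mkord -sum1_card big_mkcond; apply: eq_bigr => x _.
  by rewrite !inE -coprime_psq coprime_sym; case: coprime.
split=> //; have := cardsC pZ; rewrite CpZ card_ord; move: #|pZ| => k.
rewrite (Zp_cast psq_gt1) -mulnn -{4}(prednK (prime_gt0 p_pr)) mulnS.
by move/addIn.
Qed.

(** Negation permutes [pZ], so the sum equals its own negative; 2 is invertible because p is odd. *)
Lemma sum_pZ : \sum_(h in pZ) h = 0.
Proof.
have sumN : \sum_(h in pZ) h = - \sum_(h in pZ) h.
  rewrite -sumrN (reindex_inj oppr_inj); apply: eq_bigl => h.
  by rewrite !inE dvdn_ZpN.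
have unit2 : (2%:R : 'Z_(p ^ 2)) \is a GRing.unit.
  by rewrite unitZpE ?psq_gt1 // coprimen2 oddX p_odd orbT.
by apply: (mulrI unit2); rewrite mulr0 mulr_natl mulr2n {1}sumN addNr.
Qed.

Lemma prime_square_coset (T : {set 'Z_(p ^ 2)}) :
    #|T| = p ->
    (forall x y : 'Z_(p ^ 2), coprime x (p ^ 2) -> coprime y (p ^ 2) ->
       ncorr T x = ncorr T y) ->
  in_proper_coset T.
Proof.
move=> cardT ncorrE; have [cpZ cCpZ] := card_pZ.
have p_gt1 := prime_gt1 p_pr.
have one_pZ := one_notin_pZ.
have ncorr1 d : d \notin pZ -> ncorr T d = ncorr T 1.
  by rewrite inE -coprime_psq => co_d; apply: ncorrE => //; exact: coprime1n.
(* The p^2 pairs are sorted by difference: zero, nonzero in [pZ], and the p(p-1) units, which all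
   have the same count. *)
have total :
    (p + \sum_(d in pZ | d != 0%R) ncorr T d + p * p.-1 * ncorr T 1%R = p ^ 2)%N.
  transitivity (\sum_d ncorr T d)%N; last by rewrite sum_ncorr_all cardT.
  apply: esym; rewrite (bigID (mem pZ)) /=; congr (_ + _)%N.
    by rewrite [LHS](bigD1 0%R) ?ncorr0 ?cardT // inE dvdn0.
  rewrite (eq_bigr (fun=> ncorr T 1)) => [|d /ncorr1 //].
  rewrite sum_nat_const -cCpZ; congr (_ * _)%N.
  by apply: eq_card => d; rewrite [RHS]inE.
have [ncorr1_0|ncorr1_gt0] := posnP (ncorr T 1).
  have [x xT] : exists x, x \in T by apply/card_gt0P; rewrite cardT prime_gt0.
  exists (Group pZ_group), x; split.
    by apply/properP; split; [exact: subsetT | exists 1 => //; rewrite inE].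
  apply/subsetP => y yT; apply/imsetP; exists (y - x);
    last by rewrite addrC subrK.
  by apply: contraLR (ncorr_gt0 yT xT) => /ncorr1 ->; rewrite ncorr1_0.
exfalso.
(* As p + p(p-1) = p^2 already, a positive unit count must be 1, and nothing is left for the nonzero
   elements of [pZ]. *)
have [ncorr1_1 sum0] :
    ncorr T 1 = 1%N /\ (\sum_(d in pZ | d != 0%R) ncorr T d)%N = 0%N.
  move: total ncorr1_gt0 p_gt1.
  move: (ncorr T 1) (\sum_(d in pZ | d != 0%R) _)%N => n s; clear.
  by rewrite -mulnn; case: p => // k /=; nia.
have pZB x y : x \in pZ -> y \in pZ -> x - y \in pZ.
  by rewrite !inE => px; rewrite -dvdn_ZpN dvdn_ZpD.
(* Elements of [T] are thus pairwise incongruent modulo p. *)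
have inj_pZ x y : x \in T -> y \in T -> x - y \in pZ -> x = y.
  move=> xT yT xy_pZ; apply/eqP; rewrite -subr_eq0; apply: contraT => xy0.
  move/eqP: sum0; rewrite sum_nat_eq0 => /forallP/(_ (x - y)).
  by rewrite xy_pZ xy0 eqn0Ngt ncorr_gt0.
pose K := [pred d : 'Z_(p ^ 2) | d - 1 \in pZ].
pose D := [set w in setX T T | K (w.1 - w.2)].
have ncorrK d : K d -> ncorr T d = 1%N.
  move=> Kd; rewrite ncorr1 //; apply: contra one_pZ => pd.
  by have := pZB _ _ pd Kd; rewrite subKr.
have cardD : #|D| = p.
  rewrite card_ncorr (eq_bigr (fun=> 1%N)) //.
  transitivity #|pZ| => //; rewrite -sum1_card.
  rewrite (reindex_inj (addIr 1)); apply: eq_bigl => d.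
  by rewrite /= addrK.
(* An injection of [D] into [T] is onto, both having p elements. Applied to both projections, this
   makes the sum of differences telescope. *)
have sumD (f : 'Z_(p ^ 2) * 'Z_(p ^ 2) -> 'Z_(p ^ 2)) :
    {in D &, injective f} -> {in D, forall w, f w \in T} ->
    \sum_(w in D) f w = \sum_(x in T) x.
  move=> f_inj fT; suff <- : f @: D = T by rewrite big_imset.
  apply/eqP; rewrite eqEcard card_in_imset // cardD cardT leqnn andbT.
  by apply/subsetP => _ /imsetP[w wD ->]; apply: fT.
have DP w : w \in D -> [/\ w.1 \in T, w.2 \in T & w.1 - w.2 - 1 \in pZ].
  by rewrite !inE => /andP[/andP[]].
(* Two partners of the same element are congruent modulo p, hence equal by [inj_pZ]. *)
have fst_inj : {in D &, injective fst}.
  move=> [x y] [x' y'] /DP/=[_ yT Kxy] /DP/=[_ y'T Kxy'] Dx.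
  rewrite -{}Dx in Kxy' *; congr (_, _); apply: inj_pZ => //.
  by have := pZB _ _ Kxy' Kxy; rewrite opprB addrA subrK opprB addrC subrKA.
have snd_inj : {in D &, injective snd}.
  move=> [x y] [x' y'] /DP/=[xT _ Kxy] /DP/=[x'T _ Kxy'] Dy.
  rewrite -{}Dy in Kxy' *; congr (_, _); apply: inj_pZ => //.
  by have := pZB _ _ Kxy Kxy'; rewrite opprB addrA subrK opprB subrKA.
have sumD_0 : \sum_(w in D) (w.1 - w.2) = 0.
  by rewrite sumrB !sumD ?subrr // => w /DP[].
(* Each element of the coset 1 + [pZ] occurs once as a difference, so the sum is p plus the sum over
   [pZ]. *)
have : \sum_(w in D) (w.1 - w.2) = p%:R.
  transitivity (\sum_(d | K d) d *+ ncorr T d).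
    by rewrite -sum_ncorr; apply: eq_bigl => w; rewrite inE.
  rewrite (eq_bigr id) => [|d /ncorrK ->//].
  rewrite (reindex_inj (addIr 1)) (eq_bigl (mem pZ)) => [|d];
    last by rewrite /= addrK.
  by rewrite big_split /= sum_pZ add0r sumr_const cpZ.
rewrite sumD_0 => /(congr1 val)/=/esym/eqP.
by rewrite val_Zp_nat ?psq_gt1 // modn_small ?eqn0Ngt ?prime_gt0 //
  -{1}[p]expn1 ltn_exp2l.
Qed.
End PrimeSquare.

(** * The isomorphism of Z/N with its character group *)

Section DualGroup.
Variables (C : numClosedFieldType) (N : nat) (z : C).
Hypotheses (N_gt1 : (1 < N)%N) (prim_z : N.-primitive_root z).

Lemma zchar_subproof (y : 'Z_N) :
  is_character [ffun x : 'Z_N => z ^+ (x * y)%R].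
Proof.
apply/andP; split; apply/forallP => x.
  by rewrite ffunE (zexp_norm prim_z).
by apply/forallP => x'; rewrite !ffunE mulrDl (zexpD N_gt1).
Qed.
Definition zchar (y : 'Z_N) : char_group C 'Z_N := Character (zchar_subproof y).

Lemma zcharE (y x : 'Z_N) : zchar y x = z ^+ (x * y)%R.
Proof. by rewrite ffunE. Qed.

Lemma zcharD : {morph zchar : x y / x + y}.
Proof.
move=> x y; apply/val_inj/ffunP => v.
by rewrite [RHS]ffunE !zcharE mulrDr (zexpD N_gt1).
Qed.

(** A character is determined by its value at 1, an N-th root of unity; the inverse map takes its
    discrete logarithm to base [z]. *)
Lemma zchar_bij : bijective zchar.
Proof.
have chi1 (chi : char_group C 'Z_N) : chi 1 ^+ N = 1.
  by have := character_unity chi 1; rewrite card_ord (Zp_cast N_gt1).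
have log_chi (chi : char_group C 'Z_N) := prim_rootP prim_z (chi1 chi).
exists (fun chi => inZp (sval (log_chi chi))) => [y|chi].
  case: (log_chi _) => i /=; rewrite zcharE mul1r => /eqP.
  rewrite (eq_prim_root_expr prim_z) => /eqP eq_yi.
  by apply/val_inj; rewrite /= [in LHS](Zp_cast N_gt1) -eq_yi
    -[X in (_ %% X)%N](Zp_cast N_gt1) modn_small.
case: (log_chi _) => i /= Di; apply/val_inj/ffunP => x.
rewrite [LHS]zcharE (zexpM N_gt1) //= [X in (_ %% X)%N](Zp_cast N_gt1).
by rewrite (prim_expr_mod prim_z) -Di -characterMn -[x in RHS]natr_Zp.
Qed.
End DualGroup.

(** * Transport of [T] to Z/p^2 and case split on the size of [S] *)

Theorem proposition4p3 (R : realType) (p : nat) :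
  prime p -> odd p ->
  ~ exists (S : {set 'Z_(p ^ 2)}) (T : {set char_group R[i] 'Z_(p ^ 2)}),
      primitive_formally_dual S T.
Proof.
move=> p_pr p_odd [S [T [[S0 T0 dualST] primS primT]]].
have N_gt1 := psq_gt1 p_pr.
have [z prim_z] := prim_root_exists R[i] (ltnW N_gt1).
have [zch_bij zchD zchE] := And3 (zchar_bij N_gt1 prim_z)
  (zcharD N_gt1 prim_z) (zcharE N_gt1 prim_z).
move: (zchar N_gt1 prim_z) zch_bij zchD zchE => zch zch_bij zchD zchE.
pose T' := zch @^-1: T.
have primT' : ~ in_proper_coset T' by move/(in_proper_coset_bij zch_bij zchD).
have im_zch : zch @: T' = T.
  apply/setP => chi; apply/imsetP/idP => [[y]|chiT].
    by rewrite inE => yT ->.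
  have [zlog _ zlogK] := zch_bij.
  by exists (zlog chi); rewrite ?inE zlogK.
have zch_inj := bij_inj zch_bij.
have cardT : #|T'| = #|T| by rewrite -[in RHS]im_zch card_imset.
have T'0 : T' != set0 by rewrite -cards_eq0 cardT cards_eq0.
have zchB x y : zch (x - y) = zch x - zch y.
  by apply: (addIr (zch y)); rewrite -zchD !subrK.
(* Applying [zch] to both coordinates matches pairs in [T'] with pairs in [T]. *)
have ncorrT y : ncorr T' y = #|[set w in setX T T | zch y == w.1 - w.2]|.
  rewrite /ncorr -(card_imset _ (f := fun w => (zch w.1, zch w.2))); last first.
    by move=> [a b] [c d] /= [/zch_inj-> /zch_inj->].
  apply: eq_card => -[a b]; rewrite !inE /=; apply/imsetP/idP.
    move=> [[c d]]; rewrite !inE /= => /andP[/andP[cT dT] /eqP->] [-> ->].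
    by rewrite cT dT zchB /=.
  rewrite -{1 2}im_zch => /andP[/andP[/imsetP[c cT ->] /imsetP[d dT ->]]].
  by rewrite -zchB (inj_eq zch_inj) => ycd; exists (c, d);
    rewrite // inE /= in_setX cT dT.
have dual y : #|T'|%:R * `|\sum_(v in S) z ^+ (v * y)%R| ^+ 2
    = #|S|%:R ^+ 2 * (ncorr T' y)%:R.
  have s0 : #|S|%:R != 0 :> R[i] by rewrite pnatr_eq0 cards_eq0.
  have t0 : #|T|%:R != 0 :> R[i] by rewrite pnatr_eq0 cards_eq0.
  have := dualST (zch y); under eq_bigr do rewrite zchE.
  rewrite -ncorrT normrM normfV normr_nat exprMn exprVn => Dnorm.
  rewrite cardT; apply: (mulfI (invr_neq0 (expf_neq0 2 s0))).
  by rewrite mulrCA Dnorm mulVKf // mulKf ?expf_neq0.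
have cardST := dual_card N_gt1 prim_z S0 T'0 dual.
have cardZ : (1 < #|'Z_(p ^ 2)|)%N by rewrite card_ord.
have /(dvdn_pfactor _ _ p_pr)[k k_le2 cardS] : (#|S| %| p ^ 2)%N.
  by apply/dvdnP; exists #|T'|; rewrite mulnC cardST.
(* The sizes 1, p and p^2 of [S]: in the outer cases [S], respectively [T'], is a single point; in
   the middle one [T'] has p elements. *)
case: k k_le2 cardS => [|[|[|//]]] _ cardS.
- exact/primS/in_proper_coset_card1.
- apply/primT'/prime_square_coset => // [|x y];
    last exact: (dual_ncorr_coprime N_gt1 prim_z S0 dual).
  move: cardST; rewrite cardS; move: #|T'| => t /eqP.
  by rewrite -mulnn expn1 eqn_pmul2l ?prime_gt0 // => /eqP.
- apply/primT'/in_proper_coset_card1 => //.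
  move: cardST; rewrite cardS; move: #|T'| => t /eqP.
  by rewrite -[X in _ == X]muln1 eqn_pmul2l ?(ltnW N_gt1) // => /eqP.
Qed.
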